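(* Let $W$ be a finite group acting orthogonally on a Euclidean vector space $\mathfrak{t}$, preserving a lattice $\Gamma$ in $\mathfrak{t}$. For $w\in W$ the fixed sets $\mathcal{T}^w$ and $(\mathcal{T}^\vee)^w$ are (non-canonically) isomorphic as topological groups. In the special case of Weyl groups acting on maximal tori, this gives an isomorphism between the $w$-fixed sets for the Langlands dual forms.
   Context: $\mathfrak{t}$ is a finite-dimensional real inner product space and $\Gamma$ is a full-rank lattice in it. The dual lattice is $\Gamma^\vee=\{x\in\mathfrak{t} : \langle x,y\rangle\in\mathbb{Z}\ \text{for all } y\in\Gamma\}$ (using the inner product to identify $\mathfrak{t}^*$ with $\mathfrak{t}$), which is preserved by $W$. $\mathcal{T}=\mathfrak{t}/\Gamma$ and $\mathcal{T}^\vee=\mathfrak{t}/\Gamma^\vee$ (equivalently $\mathfrak{t}^*/\Gamma^\vee$) carry the induced $W$-actions, and $\mathcal{T}^w$, $(\mathcal{T}^\vee)^w$ are the closed subgroups of points fixed by $w$. In the Weyl group case, $\mathcal{T}=\mathfrak{t}/\Gamma$ is a maximal torus of a compact connected semisimple Lie group with Weyl group $W$, where $\Gamma$ is the kernel of the exponential map $\mathfrak{t}\to\mathcal{T}$, and $\mathcal{T}^\vee$ is the corresponding maximal torus of the Langlands dual group. *)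

(* Defs.v *)
From HB Require Import structures.
From mathcomp Require Import all_boot all_order all_algebra all_fingroup.
From mathcomp Require Import all_classical all_reals all_analysis.
From mathcomp Require Import generic_quotient ring.

Set Implicit Arguments.
Unset Strict Implicit.
Unset Printing Implicit Defensive.

Import Order.TTheory GRing.Theory Num.Theory.
Import numFieldNormedType.Exports.

Local Open Scope classical_set_scope.
Local Open Scope ring_scope.
Local Open Scope quotient_scope.

HB.structure Definition FinDimNormedModule (R : realType) :=
  {E of NormedModule R E & Vector R E}.

(* [{dot E for idfun}]: positive definite symmetric bilinear forms; the norm,
   hence the topology, is the one given by the inner product. *)
HB.mixin Record isEuclidean (R : realType) E of FinDimNormedModule R E := {
  dot : {dot E for idfun};
  sqr_normE : forall x : E, `|x| ^+ 2 = dot x x }.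

#[short(type="euclideanType")]
HB.structure Definition Euclidean (R : realType) :=
  {E of FinDimNormedModule R E & isEuclidean R E}.

Section EuclideanTheory.
Variables (R : realType) (t : euclideanType R).
Implicit Types x y z : t.

Lemma dotC x y : dot x y = dot y x.
Proof. by rewrite [LHS]hermitian_subproof /= expr0 mul1r. Qed.

Lemma dotDl x y z : dot (x + y) z = dot x z + dot y z.
Proof. exact: linearDl. Qed.

Lemma dotDr x y z : dot z (x + y) = dot z x + dot z y.
Proof. by rewrite dotC dotDl !(dotC z). Qed.

Lemma dotZl (c : R) x y : dot (c *: x) y = c * dot x y.
Proof. exact: linearZl_LR. Qed.

Lemma dotZr (c : R) x y : dot x (c *: y) = c * dot x y.
Proof. by rewrite dotC dotZl dotC. Qed.

Lemma dot0l x : dot 0 x = 0.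
Proof. by rewrite -(scale0r x) dotZl mul0r. Qed.

Lemma dot0r x : dot x 0 = 0. Proof. by rewrite dotC dot0l. Qed.

Lemma dotNl x y : dot (- x) y = - dot x y.
Proof. by rewrite -scaleN1r dotZl mulN1r. Qed.

Lemma dotNr x y : dot x (- y) = - dot x y.
Proof. by rewrite dotC dotNl dotC. Qed.

Lemma dotBl x y z : dot (x - y) z = dot x z - dot y z.
Proof. by rewrite dotDl dotNl. Qed.

Lemma dotBr x y z : dot z (x - y) = dot z x - dot z y.
Proof. by rewrite dotDr dotNr. Qed.

Lemma dot_suml (I : Type) (r : seq I) (P : pred I) (F : I -> t) y :
  dot (\sum_(i <- r | P i) F i) y = \sum_(i <- r | P i) dot (F i) y.
Proof.
by apply: (big_morph (fun x => dot x y)); [move=> u v; exact: dotDl|exact: dot0l].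
Qed.

Lemma dot_sumr (I : Type) (r : seq I) (P : pred I) (F : I -> t) y :
  dot y (\sum_(i <- r | P i) F i) = \sum_(i <- r | P i) dot y (F i).
Proof. by rewrite dotC dot_suml; apply: eq_bigr => i _; exact: dotC. Qed.

Lemma dot_eq0 x : (dot x x == 0) = (x == 0).
Proof. by rewrite -sqr_normE sqrf_eq0 normr_eq0. Qed.

End EuclideanTheory.

Section Lattices.
Variables (R : realType) (t : euclideanType R).

(* The integer span of a basis of the whole of [t] (full rank). *)
Definition is_lattice (L : zmodClosed t) : Prop :=
  exists e : (\dim {:t}).-tuple t,
    basis_of fullv e /\ forall x, x \in L <-> inIntSpan e x.

Definition dual_lattice (L : zmodClosed t) : {pred t} :=
  [pred x : t | `[< forall y, y \in L -> dot x y \is a Num.int >]].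

Lemma dual_latticeP (L : zmodClosed t) x :
  reflect (forall y, y \in L -> dot x y \is a Num.int) (x \in dual_lattice L).
Proof. by rewrite inE; exact: asboolP. Qed.

Lemma dual_lattice_zmod_closed (L : zmodClosed t) :
  zmod_closed (dual_lattice L).
Proof.
split=> [|x y /dual_latticeP hx /dual_latticeP hy]; apply/dual_latticeP => z zL.
  by rewrite dot0l rpred0.
by rewrite dotBl rpredB ?hx ?hy.
Qed.

HB.instance Definition _ (L : zmodClosed t) :=
  GRing.isZmodClosed.Build t (dual_lattice L) (dual_lattice_zmod_closed L).

Lemma dual_basis (e : (\dim {:t}).-tuple t) : basis_of fullv e ->
  exists f : (\dim {:t}).-tuple t, basis_of fullv f /\
    forall i j : 'I_(\dim {:t}), dot f`_i e`_j = (i == j)%:R.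
Proof.
move=> be; have fe := basis_free be.
pose G := \matrix_(i < \dim {:t}, j < \dim {:t}) dot e`_i e`_j.
have Gu : G \in unitmx.
  rewrite -row_free_unit; apply: inj_row_free => v vG.
  pose x := \sum_i v 0 i *: e`_i.
  have xe j : dot x e`_j = 0.
    have [jlt|jge] := ltnP j (size e); last by rewrite nth_default// dot0r.
    rewrite size_tuple in jlt; have := congr1 (fun M : 'rV_ _ => M 0 (Ordinal jlt)) vG.
    rewrite !mxE => <-; rewrite dot_suml; apply: eq_bigr => i _.
    by rewrite mxE dotZl.
  have /eqP x0 : x == 0.
    rewrite -dot_eq0 {2}/x dot_sumr big1// => i _.
    by rewrite dotZr xe mulr0.
  by apply/rowP => i; rewrite mxE; move/freeP: fe; apply; exact: x0.
pose f := mktuple (fun i => \sum_j (invmx G) i j *: e`_j).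
have fe1 (i j : 'I_(\dim {:t})) : dot f`_i e`_j = (i == j)%:R.
  rewrite -tnth_nth tnth_mktuple dot_suml.
  have := congr1 (fun M : 'M[R]_(\dim {:t}) => M i j) (mulVmx Gu); rewrite !mxE => <-.
  by apply: eq_bigr => k _; rewrite mxE dotZl.
exists f; split=> //; rewrite basisEfree subvf size_tuple leqnn !andbT.
apply/freeP => k k0 j; have := congr1 (fun x => dot x e`_j) k0.
rewrite dot0l dot_suml (bigD1 j)//= dotZl fe1 eqxx mulr1 big1 ?addr0// => i ij.
by rewrite dotZl fe1 (negbTE ij) mulr0.
Qed.

Lemma dual_lattice_is_lattice (L : zmodClosed t) :
  is_lattice L -> is_lattice (dual_lattice L).
Proof.
move=> [e [be Le]]; have [f [bf fe]] := dual_basis be.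
exists f; split=> // x; split.
  move=> /dual_latticeP xL.
  have eL (i : 'I_(\dim {:t})) : e`_i \in L.
    apply/Le; exists [ffun j : 'I_(\dim {:t}) => (j == i)%:R]; rewrite (bigD1 i)//= ffunE eqxx.
    by rewrite mulr1z big1 ?addr0// => j ji; rewrite ffunE (negbTE ji) mulr0z.
  exists [ffun i : 'I_(\dim {:t}) => Num.floor (dot x e`_i)].
  set y := \sum_i _; have ye (j : 'I_(\dim {:t})) : dot (x - y) e`_j = 0.
    rewrite dotBl dot_suml (bigD1 j)//= ffunE -scaler_int dotZl fe eqxx mulr1.
    rewrite (floorK (xL _ (eL j))) big1 ?addr0 ?subrr// => i ij.
    by rewrite -scaler_int dotZl fe (negbTE ij) mulr0.
  apply/eqP; rewrite -subr_eq0 -dot_eq0.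
  rewrite {2}(coord_basis be (memvf (x - y))) dot_sumr big1// => i _.
  by rewrite dotZr ye mulr0.
move=> [a ->]; apply/dual_latticeP => y /Le[b ->].
rewrite dot_suml rpred_sum// => i _; rewrite dot_sumr rpred_sum// => j _.
rewrite -(scaler_int (a i)) -(scaler_int (b j)) dotZl dotZr fe; apply: rpredM; first exact: intr_int.
apply: rpredM; first exact: intr_int.
exact: natr_int.
Qed.

End Lattices.

Section Torus.
Variables (R : realType) (t : euclideanType R) (L : zmodClosed t).

(* [t / L] with the quotient group structure and the quotient topology. *)
Definition torus : Type := quotient_topology (Quotient.quot L).

HB.instance Definition _ := Topological.on torus.
HB.instance Definition _ := Quotient.on torus.
HB.instance Definition _ := GRing.isZmodule.Build torus
  (@Quotient.addqA t L) (@Quotient.addqC t L) (@Quotient.add0q t L)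
  (@Quotient.addNq t L).

Lemma pi_torusB (x y : t) : \pi_torus (x - y) = \pi_torus x - \pi_torus y.
Proof.
exact: (raddfB (\pi_(Quotient.quot L) : {additive t -> Quotient.quot L})).
Qed.

Lemma pi_torusP (x y : t) : \pi_torus x = \pi_torus y <-> x - y \in L.
Proof.
by rewrite (Quotient.idealrBE L); split=> [h|/eqP h]; [apply/eqP|]; exact: h.
Qed.

Lemma pi_torus_open (A : set t) :
  open A -> open ((\pi_torus : t -> torus) @` A).
Proof.
move=> oA; rewrite /open /= /quotient_open.
rewrite (_ : _ @^-1` _ = \bigcup_(l in [set l | l \in L])
    ((fun x => x - l) @^-1` A)); last first.
  apply/seteqP; split=> x /=.
    move=> [a Aa /pi_torusP axL]; exists (x - a) => /=.
      by rewrite -opprB rpredN.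
    by rewrite /= opprB addrC subrK.
  move=> [l /= lL Axl]; exists (x - l) => //; apply/pi_torusP.
  by rewrite addrAC subrr add0r rpredN.
apply: bigcup_open => l _; apply: open_comp => // x _.
by apply: continuousB; [exact: cvg_id|exact: cvg_cst].
Qed.

Lemma torus_sub_continuous :
  continuous (fun x : torus * torus => x.1 - x.2).
Proof.
move=> [a b] U /=; pose x := repr (a : torus); pose y := repr (b : torus).
have -> : a = \pi_torus x by rewrite reprK.
have -> : b = \pi_torus y by rewrite reprK.
rewrite -pi_torusB => nU.
have : nbhs (x - y) ((\pi_torus : t -> torus) @^-1` U).
  exact: (@pi_continuous t (Quotient.quot L) _ _ nU).
move/(@sub_continuous t (x, y)) => [[A B] /= [nA nB] AB].
exists ((\pi_torus : t -> torus) @` A, (\pi_torus : t -> torus) @` B) => /=.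
  have nbhs_pi (z : t) (C : set t) : nbhs z C ->
      nbhs (\pi_torus z) ((\pi_torus : t -> torus) @` C).
    rewrite nbhsE => -[D [oD Dz] DC]; rewrite nbhsE.
    exists ((\pi_torus : t -> torus) @` D); last exact: image_subset.
    by split; [exact: pi_torus_open|exists z].
  by split; exact: nbhs_pi.
move=> [_ _] /= [[u Au <-] [v Bv <-]]; rewrite -pi_torusB.
exact: (AB (u, v)).
Qed.

HB.instance Definition _ :=
  PreTopologicalNmodule_isTopologicalZmodule.Build torus torus_sub_continuous.

Definition torus_map (f : t -> t) (q : torus) : torus := \pi_torus (f (repr q)).

Lemma torus_map_pi (f : t -> t) : zmod_morphism f ->
  {in L, forall x, f x \in L} ->
  forall x, torus_map f (\pi_torus x) = \pi_torus (f x).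
Proof.
move=> fB fL x; apply/pi_torusP; rewrite -fB; apply: fL.
by apply/pi_torusP; rewrite reprK.
Qed.

Definition torus_fixed (f : t -> t) : set torus := [set q | torus_map f q = q].

End Torus.
Arguments torus_map {R t} L f q.
Arguments torus_fixed {R t} L f.

Definition top_group_iso (G H : topologicalZmodType) (A : set G) (B : set H) :
    Prop :=
  exists (f : G -> H) (g : H -> G),
  [/\ set_fun A B f, set_fun B A g,
      (forall x, A x -> g (f x) = x) & (forall y, B y -> f (g y) = y)] /\
  [/\ (forall x y, A x -> A y -> f (x + y) = f x + f y),
      {within A, continuous f} & {within B, continuous g}].

Section FiniteGroupActions.
Variables (R : realType) (t : euclideanType R) (W : finGroupType).

Record orthogonal_action (act : W -> t -> t) : Prop := OrthogonalAction {
  oact1 : forall x, act 1%g x = x;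
  oactM : forall v w x, act (v * w)%g x = act v (act w x);
  oact_linear : forall w, linear (act w);
  oact_dot : forall w x y, dot (act w x) (act w y) = dot x y }.

Definition preserves (act : W -> t -> t) (L : zmodClosed t) : Prop :=
  forall w x, x \in L -> act w x \in L.

Lemma preserves_dual (act : W -> t -> t) (L : zmodClosed t) :
  orthogonal_action act -> preserves act L -> preserves act (dual_lattice L).
Proof.
move=> oW WL w x /dual_latticeP xL; apply/dual_latticeP => y yL.
rewrite -[y](oact1 oW) -(mulgV w) (oactM oW) (oact_dot oW).
exact/xL/WL.
Qed.

End FiniteGroupActions.

Section RootData.
Variables (R : realType) (t : euclideanType R).

Definition coroot (a : t) : t := (2 / dot a a) *: a.

Definition reflection (a x : t) : t := x - dot x (coroot a) *: a.

Record is_root_system (Phi : seq t) : Prop := IsRootSystem {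
  root_span : <<Phi>>%VS = fullv;
  root_neq0 : 0 \notin Phi;
  root_reflection : {in Phi &, forall a b, reflection a b \in Phi};
  root_integral : {in Phi &, forall a b, dot b (coroot a) \is a Num.int};
  root_reduced : forall a (c : R), a \in Phi -> c *: a \in Phi ->
    c = 1 \/ c = -1 }.

(* The root datum of a compact connected semisimple group with respect to a
   maximal torus [T = t / L]: [t] is the Lie algebra of [T] with an invariant
   inner product, [L] the kernel of the exponential map (cocharacter lattice),
   and the roots are the linear forms [dot ^~ a], so that [dual_lattice L] is
   the character lattice. *)
Record rootDatum := RootDatum {
  roots : seq t;
  cochar : zmodClosed t;
  roots_root_system : is_root_system roots;
  cochar_lattice : is_lattice cochar;
  roots_char : {in roots, forall a, a \in dual_lattice cochar};
  coroots_cochar : {in roots, forall a, coroot a \in cochar} }.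

(* The Weyl group, as a set of linear automorphisms of [t]. *)
Inductive weyl_group (D : rootDatum) : (t -> t) -> Prop :=
| weyl_id : weyl_group D id
| weyl_reflection a w : a \in roots D -> weyl_group D w ->
    weyl_group D (reflection a \o w).

Lemma corootK a : coroot (coroot a) = a.
Proof.
have [->|a0] := eqVneq a 0; first by rewrite /coroot !scaler0.
have aa : dot a a != 0 by rewrite dot_eq0.
rewrite /coroot !(dotZl, dotZr) scalerA.
rewrite [X in X *: _](_ : _ = 1) ?scale1r//.
by field.
Qed.

Lemma reflection_coroot a : reflection (coroot a) =1 reflection a.
Proof.
move=> x; rewrite /reflection corootK; congr (x - _).
by rewrite /coroot dotZr scalerA; congr (_ *: _); ring.
Qed.

Lemma reflectionD a x y : reflection a (x + y) = reflection a x + reflection a y.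
Proof. by rewrite /reflection dotDl scalerDl opprD addrACA. Qed.

Lemma reflectionZ a (c : R) x : reflection a (c *: x) = c *: reflection a x.
Proof. by rewrite /reflection dotZl scalerBr scalerA. Qed.

Lemma dot_reflection a x y : dot (reflection a x) (reflection a y) = dot x y.
Proof.
have [->|a0] := eqVneq a 0.
  by rewrite /reflection /coroot !scaler0 !subr0.
have aa : dot a a != 0 by rewrite dot_eq0.
rewrite /reflection /coroot !(dotBl, dotBr, dotZl, dotZr) (dotC a y).
by field.
Qed.

Lemma reflectionK a : involutive (reflection a).
Proof.
move=> x; have [->|a0] := eqVneq a 0; first by rewrite /reflection !scaler0 !subr0.
have aa : dot a a != 0 by rewrite dot_eq0.
rewrite /reflection /coroot !(dotBl, dotZl, dotZr) -addrA -opprD -scalerDl.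
rewrite [X in X *: _](_ : _ = 0) ?scale0r ?subr0//.
by field.
Qed.

Lemma coroot_reflection a x : coroot (reflection a x) = reflection a (coroot x).
Proof. by rewrite {1}/coroot dot_reflection /coroot reflectionZ. Qed.

Lemma coroot_eq0 a : (coroot a == 0) = (a == 0).
Proof.
by rewrite scaler_eq0 mulf_eq0 invr_eq0 pnatr_eq0 dot_eq0 orbb.
Qed.

Lemma coroots_root_system (Phi : seq t) :
  is_root_system Phi -> is_root_system (map coroot Phi).
Proof.
move=> [sP nP rP iP redP]; split.
- apply/eqP; rewrite eqEsubv subvf /= -sP; apply/span_subvP => a aP.
  rewrite -[a]corootK {1}/coroot memvZ// memv_span//.
  exact: map_f.
- apply/mapP => -[a aP /esym/eqP]; rewrite coroot_eq0 => /eqP a0.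
  by move: nP; rewrite -a0 aP.
- move=> _ _ /mapP[a aP ->] /mapP[b bP ->].
  by rewrite reflection_coroot -coroot_reflection map_f// rP.
- move=> _ _ /mapP[a aP ->] /mapP[b bP ->].
  by rewrite corootK dotC iP.
- move=> _ c /mapP[a aP ->] /mapP[b bP cab].
  have a0 : a != 0 by apply: contraNneq nP => <-.
  have b0 : b != 0 by apply: contraNneq nP => <-.
  have c0 : c != 0.
    apply: contraNneq b0 => c0; rewrite -coroot_eq0 -cab c0 scale0r//.
  have ba : b = c^-1 *: a.
    rewrite -[b]corootK -cab /coroot !(dotZl, dotZr) !scalerA.
    congr (_ *: _); have aa : dot a a != 0 by rewrite dot_eq0.
    by field; rewrite c0.
  move: bP; rewrite ba => /(redP _ _ aP)[] h; [left|right].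
    by rewrite -[c]invrK h invr1.
  by rewrite -[c]invrK h invrN1.
Qed.

(* The root datum of the Langlands dual group: roots and coroots, characters
   and cocharacters, are exchanged. *)
Program Definition langlands_dual (D : rootDatum) : rootDatum :=
  @RootDatum (map coroot (roots D)) (dual_lattice (cochar D))
    (coroots_root_system (roots_root_system D))
    (dual_lattice_is_lattice (cochar_lattice D)) _ _.
Next Obligation.
move=> D _ /mapP[a aD ->]; apply/dual_latticeP => y /dual_latticeP yL.
by rewrite dotC; apply/yL/coroots_cochar.
Qed.
Next Obligation.
by move=> D _ /mapP[a aD ->]; rewrite corootK; exact: roots_char.
Qed.

Lemma weyl_group_dual (D : rootDatum) (w : t -> t) :
  weyl_group (langlands_dual D) w <-> weyl_group D w.
Proof.
split; elim=> [|a {}w aD _ IH]; try exact: weyl_id.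
  move/mapP: aD => [b bD ->].
  rewrite (_ : reflection _ = reflection b); first exact: weyl_reflection.
  by apply/funext => x; exact: reflection_coroot.
rewrite (_ : reflection a = reflection (coroot a)).
  by apply: weyl_reflection => //; exact: map_f.
by apply/funext => x; rewrite reflection_coroot.
Qed.

End RootData.

(* Main.v *)
Require Import Defs.
From HB Require Import structures.
From mathcomp Require Import all_boot all_order all_algebra all_fingroup.
From mathcomp Require Import all_classical all_reals all_analysis.
From mathcomp Require Import generic_quotient ring.

(** Let [h = w - 1], which maps the lattice [L] to itself.  The Smith normal
form of the integer matrix of [h] gives two integral bases [a], [b] of [L] and
integers [d i] with [h (a i) = d i b i].  Let [a'], [b'] be the dual bases,
which are integral bases of the dual lattice.

Write [x = \sum_i x_i a_i].  The class of [x] in [t / L] is fixed by [w] iff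
[h x = \sum_i d_i x_i b_i] lies in [L], that is, iff every [d_i x_i] is an
integer.  On the dual side the adjoint of [h] is diagonal with the same
entries: it sends [b' i] to [d i a' i].  Since [w] is orthogonal, this adjoint
is [w^-1 - 1 = - w^-1 h], and [w] preserves the dual lattice, so the class of
[y = \sum_i y_i b'_i] in [t / L^v] is fixed by [w] iff every [d_i y_i] is an
integer.  The conditions agree, so the linear map sending [a i] to [b' i]
([transfer a' b'] below) carries [L] onto its dual and one fixed set onto the
other.  The isomorphism obtained is thus induced by an isomorphism of the whole
tori, which in general does not commute with [w]; the choice of the Smith bases
is what makes it non-canonical.

The main steps are [smith_dual_bases] (the diagonalisation), [dual_fixedP] (the
fixed points in the dual torus in terms of the adjoint), [torus_fixed_iso] (from
maps of [t] to fixed subgroups) and [torus_fixed_dual_iso].  The case of Weyl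
groups is an instance: a Weyl group element is an isometry permuting the
cocharacter lattice, because reflections are and do, and the cocharacter lattice
of the Langlands dual datum is by definition the dual lattice. *)

Set Implicit Arguments.
Unset Strict Implicit.
Unset Printing Implicit Defensive.

Import Order.TTheory GRing.Theory Num.Theory.
Import numFieldNormedType.Exports.

Local Open Scope classical_set_scope.
Local Open Scope ring_scope.
Local Open Scope quotient_scope.

(** * Integral bases of a lattice and of its dual *)

Section DualBases.
Variables (R : realType) (t : euclideanType R) (n : nat).
Implicit Types (L : zmodClosed t) (a b : 'I_n -> t).

(** An integral basis [a] of [L] with its dual basis [a'].  Membership, duality
and the expansion formula are recorded rather than integral spans, since
coordinates are always read off as inner products. *)
Record dual_bases L a a' : Prop := DualBases {
  dual_bases_dot : forall i j, dot (a i) (a' j) = (i == j)%:R;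
  dual_bases_expand : forall x, x = \sum_i dot x (a' i) *: a i;
  dual_bases_mem : forall i, a i \in L;
  dual_bases_mem_dual : forall i, a' i \in dual_lattice L }.

(** The expansion in [a'] holds because the two sides have the same inner
product with every [a i], and the [a i] span. *)
Lemma dual_bases_sym L a a' :
  dual_bases L a a' -> dual_bases (dual_lattice L) a' a.
Proof.
move=> [aa' ea aL a'L]; split=> // [i j|x|i].
- by rewrite dotC aa' eq_sym.
- apply/eqP; rewrite -subr_eq0 -dot_eq0.
  set y := x - _; have ya j : dot y (a j) = 0.
    rewrite dotBl dot_suml (bigD1 j)//= dotZl [dot (a' j) _]dotC aa' eqxx mulr1.
    rewrite big1 ?addr0 ?subrr// => i ij.
    by rewrite dotZl dotC aa' eq_sym (negbTE ij) mulr0.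
  by rewrite {2}(ea y) dot_sumr big1// => i _; rewrite dotZr ya mulr0.
- by apply/dual_latticeP => y /dual_latticeP yL; rewrite dotC; exact/yL/aL.
Qed.

Lemma dual_bases_memP L a a' x :
  dual_bases L a a' -> x \in L <-> forall i, dot x (a' i) \is a Num.int.
Proof.
move=> [_ ea aL a'L]; split=> [xL i|x_int].
  by rewrite dotC; move/dual_latticeP: (a'L i); apply.
rewrite (ea x) rpred_sum// => i _; have /intrP[m ->] := x_int i.
by rewrite scaler_int rpredMz.
Qed.

Definition int_comb (M : 'M[int]_n) a i : t := \sum_j a j *~ M i j.

Lemma int_combM M N a : int_comb (M *m N) a =1 int_comb M (int_comb N a).
Proof.
move=> i; rewrite /int_comb.
under [RHS]eq_bigr => j _ do rewrite mulrz_suml.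
rewrite exchange_big; apply: eq_bigr => k _ /=.
rewrite mxE mulrz_sumr; apply: eq_bigr => j _.
by rewrite mulrC mulrzA.
Qed.

Lemma int_comb1 a : int_comb 1%:M a =1 a.
Proof.
move=> i; rewrite /int_comb (bigD1 i)//= mxE eqxx big1 ?addr0// => j ji.
by rewrite mxE eq_sym (negbTE ji).
Qed.

Lemma dot_int_combr M a i x :
  dot x (int_comb M a i) = \sum_j dot x (a j) * (M i j)%:~R.
Proof.
rewrite dot_sumr; apply: eq_bigr => j _.
by rewrite -scaler_int dotZr mulrC.
Qed.

(** A change of basis by [U] in [GL_n(Z)] acts on the dual basis by the inverse
transpose of [U]. *)
Lemma dual_bases_int_comb L a a' (U : 'M[int]_n) : U \in unitmx ->
  dual_bases L a a' -> dual_bases L (int_comb U a) (int_comb (invmx U)^T a').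
Proof.
move=> Uu [aa' ea aL a'L]; split=> [i j|x|i|i].
- rewrite dot_int_combr.
  transitivity (((U *m invmx U) i j)%:~R : R); last first.
    by rewrite mulmxV// mxE; case: eqP.
  rewrite mxE rmorph_sum; apply: eq_bigr => k _.
  rewrite dotC dot_int_combr (bigD1 k)//= dotC aa' eqxx mul1r mxE.
  rewrite big1 ?addr0 ?rmorphM// => l lk.
  by rewrite dotC aa' (negbTE lk) mul0r.
- rewrite {1}(ea x).
  under [RHS]eq_bigr => i _ do rewrite dot_int_combr scaler_suml.
  rewrite exchange_big; apply: eq_bigr => j _ /=.
  rewrite -[in LHS](int_comb1 a j) -(mulVmx Uu) int_combM scaler_sumr.
  apply: eq_bigr => i _.
  by rewrite mxE -scaler_int scalerA.
- by rewrite rpred_sum// => j _; rewrite rpredMz.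
- by rewrite rpred_sum// => j _; rewrite rpredMz.
Qed.

Lemma dual_bases_coord_int L a a' x : dual_bases L a a' -> x \in L ->
  exists m : 'I_n -> int, x = \sum_i a i *~ m i.
Proof.
move=> aa' /(dual_bases_memP _ aa') x_int.
exists (fun i => Num.floor (dot x (a' i))).
have [_ ea _ _] := aa'; rewrite [LHS]ea; apply: eq_bigr => i _.
by rewrite -scaler_int floorK.
Qed.

(** * Diagonalisation of a lattice endomorphism *)

(** If [h] has matrix [A = P D Q] in the basis [a], with [D] the Smith normal
form, then the rows of [P^-1] and of [Q] are the coordinates of the two new
bases, because [P^-1 A = D Q]. *)
Lemma smith_dual_bases L (h : t -> t) a a' :
  zmod_morphism h -> {in L, forall x, h x \in L} -> dual_bases L a a' ->
  exists u u' v v' : 'I_n -> t, exists d : 'I_n -> int,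
    [/\ dual_bases L u u', dual_bases L v v' & forall i, h (u i) = v i *~ d i].
Proof.
move=> hB hL aa'; have [_ _ aL _] := aa'.
have /choice[A hA] i : exists m : 'I_n -> int, h (a i) = \sum_j a j *~ m j.
  exact: (dual_bases_coord_int aa' (hL _ (aL i))).
pose hz := GRing.isZmodMorphism.Build t t h hB.
pose ha : {additive t -> t} := HB.pack h hz.
have h_comb M i : h (int_comb M a i) = int_comb (M *m \matrix_(k, j) A k j) a i.
  rewrite int_combM -[h]/(ha : t -> t) raddf_sum; apply: eq_bigr => j _.
  rewrite raddfMz /= hA; congr (_ *~ _).
  by apply: eq_bigr => k _; rewrite mxE.
have [P Pu [Q Qu [s _ AE]]] := int_Smith_normal_form (\matrix_(k, j) A k j).
exists (int_comb (invmx P) a), (int_comb (invmx (invmx P))^T a').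
exists (int_comb Q a), (int_comb (invmx Q)^T a'), (fun i => s`_i).
split; [by apply: dual_bases_int_comb => //; rewrite unitmx_inv
       |exact: dual_bases_int_comb|move=> i].
rewrite h_comb AE -mulmxA mulKmx// int_combM {1}/int_comb (bigD1 i)//= mxE eqxx.
rewrite big1 ?addr0// => j ji.
by rewrite mxE eq_sym val_eqE (negbTE ji).
Qed.

End DualBases.

Lemma lattice_dual_bases (R : realType) (t : euclideanType R)
    (L : zmodClosed t) : is_lattice L ->
  exists a a' : 'I_(\dim {:t}) -> t, dual_bases L a a'.
Proof.
move=> [e [be Le]]; have [f [_ fe]] := dual_basis be.
have eL (i : 'I_(\dim {:t})) : e`_i \in L.
  apply/Le; exists [ffun j => (j == i)%:R]; rewrite (bigD1 i)//= ffunE eqxx.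
  by rewrite mulr1z big1 ?addr0// => j ji; rewrite ffunE (negbTE ji) mulr0z.
exists (fun i => e`_i), (fun i => f`_i); split=> // [i j|x|i].
- by rewrite dotC fe eq_sym.
- rewrite [LHS](coord_basis be (memvf x)); apply: eq_bigr => i _.
  congr (_ *: _); rewrite [in RHS](coord_basis be (memvf x)).
  rewrite dot_suml (bigD1 i)//= dotZl dotC fe eqxx mulr1 big1 ?addr0// => j ji.
  by rewrite dotZl dotC fe eq_sym (negbTE ji) mulr0.
- apply/dual_latticeP => y /Le[m ->]; rewrite dot_sumr rpred_sum// => j _.
  by rewrite -scaler_int dotZr fe rpredM ?intr_int ?natr_int.
Qed.

(** * Linear maps exchanging two bases *)

Section Transfer.
Variables (R : realType) (t : euclideanType R).

(** By polarisation, the inner product is a combination of squared norms. *)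
Lemma dot_continuous (y : t) : continuous (fun x : t => dot x y : R).
Proof.
have -> : (fun x : t => dot x y : R) =
    (fun x => (`|x + y| ^+ 2 - `|x| ^+ 2 - `|y| ^+ 2) / 2).
  apply/funext => x; rewrite !sqr_normE dotDl !dotDr [dot y x]dotC.
  by field.
have sqrn_cont (z : t) : continuous (fun x : t => `|x + z| ^+ 2 : R).
  rewrite /continuous_at => x; under eq_fun do rewrite expr2.
  rewrite expr2.
  have nxz : `|u + z| @[u --> x] --> `|x + z|.
    by apply: cvg_norm; apply: cvgD; [exact: cvg_id|exact: cvg_cst].
  exact: cvgM.
move=> x; apply: cvgMr_tmp; apply: cvgB; last exact: cvg_cst.
apply: cvgB; first exact: sqrn_cont.
rewrite -[x in `|x|]addr0; under eq_fun do rewrite -[x in `|x|]addr0.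
exact: sqrn_cont.
Qed.

(** When [u] is the dual basis of a basis [a], this is the linear map sending
[a i] to [v i]. *)
Definition transfer n (u v : 'I_n -> t) (x : t) : t :=
  \sum_i dot x (u i) *: v i.

Lemma transfer_zmod_morphism n (u v : 'I_n -> t) : zmod_morphism (transfer u v).
Proof.
move=> x y; rewrite /transfer -sumrB; apply: eq_bigr => i _.
by rewrite dotBl scalerBl.
Qed.

Lemma transfer_continuous n (u v : 'I_n -> t) : continuous (transfer u v).
Proof.
apply: (continuous_big (op := +%R)) => [|i _ x].
  exact: add_continuous.
by apply: cvgZr_tmp; exact: dot_continuous.
Qed.

Lemma dot_transfer n (L : zmodClosed t) (u v v' : 'I_n -> t) x i :
  dual_bases L v v' -> dot (transfer u v x) (v' i) = dot x (u i).
Proof.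
move=> [vv' _ _ _]; rewrite dot_suml (bigD1 i)//= dotZl vv' eqxx mulr1.
by rewrite big1 ?addr0// => j ji; rewrite dotZl vv' (negbTE ji) mulr0.
Qed.

Lemma transferK n (L L' : zmodClosed t) (u u' v v' : 'I_n -> t) :
  dual_bases L u u' -> dual_bases L' v v' ->
  cancel (transfer u' v) (transfer v' u).
Proof.
move=> [_ eu _ _] vv' x; rewrite [RHS]eu; apply: eq_bigr => i _.
by rewrite (dot_transfer _ _ _ vv').
Qed.

Lemma transfer_mem n (L L' : zmodClosed t) (u u' v v' : 'I_n -> t) :
  dual_bases L u u' -> dual_bases L' v v' ->
  {in L, forall x, transfer u' v x \in L'}.
Proof.
move=> uu' vv' x /(dual_bases_memP _ uu') x_int.
by apply/(dual_bases_memP _ vv') => i; rewrite (dot_transfer _ _ _ vv').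
Qed.

End Transfer.

(** * Homomorphisms of tori *)

Lemma torus_ind (R : realType) (t : euclideanType R) (L : zmodClosed t)
    (P : torus L -> Prop) :
  (forall x : t, P (\pi_(torus L) x)) -> forall q, P q.
Proof. by move=> Ppi q; rewrite -[q]reprK; exact: Ppi. Qed.

Section TorusHom.
Variables (R : realType) (t : euclideanType R) (L L' : zmodClosed t).

(** The map of tori induced by [f], meaningful when [f] is additive and maps
[L] to [L']; it is defined on representatives, like [torus_map]. *)
Definition torus_hom (f : t -> t) (q : torus L) : torus L' :=
  \pi_(torus L') (f (repr q)).

Variable f : t -> t.
Hypotheses (fB : zmod_morphism f) (fL : {in L, forall x, f x \in L'}).

Lemma torus_hom_pi x : torus_hom f (\pi_(torus L) x) = \pi_(torus L') (f x).
Proof.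
by apply/pi_torusP; rewrite -fB; apply: fL; apply/pi_torusP; rewrite reprK.
Qed.

Lemma torus_homD p q : torus_hom f (p + q) = torus_hom f p + torus_hom f q.
Proof.
pose fz := GRing.isZmodMorphism.Build t t f fB.
pose fa : {additive t -> t} := HB.pack f fz.
have fD x y : f (x + y) = f x + f y by exact: (raddfD fa).
have piD (K : zmodClosed t) x y :
    \pi_(torus K) (x + y) = \pi_(torus K) x + \pi_(torus K) y.
  exact: (raddfD (\pi_(Quotient.quot K) : {additive t -> Quotient.quot K})).
by rewrite -(reprK p) -(reprK q) -piD !torus_hom_pi fD piD.
Qed.

Lemma torus_hom_continuous : continuous f -> continuous (torus_hom f).
Proof.
move=> fc; apply/quotient_continuous.
have -> : torus_hom f \o \pi_(torus L) = \pi_(torus L') \o f.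
  by apply/funext => x /=; rewrite torus_hom_pi.
by move=> x; apply: continuous_comp; [exact: fc|exact: pi_continuous].
Qed.

End TorusHom.

(** * Fixed points in a torus and in its dual *)

Section FixedSets.
Variables (R : realType) (t : euclideanType R).

Lemma torus_fixed_pi (L : zmodClosed t) (w : t -> t) x : zmod_morphism w ->
  {in L, forall x, w x \in L} ->
  torus_fixed L w (\pi_(torus L) x) <-> w x - x \in L.
Proof.
by move=> wB wL; rewrite /torus_fixed /= torus_map_pi//; exact: pi_torusP.
Qed.

(** The map [f] need not commute with [w]: it is enough that it match the two
lattice conditions that express being fixed. *)
Lemma torus_fixed_iso (L L' : zmodClosed t) (w f g : t -> t) :
  zmod_morphism w -> {in L, forall x, w x \in L} ->
  {in L', forall x, w x \in L'} ->
  zmod_morphism f -> zmod_morphism g -> continuous f -> continuous g ->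
  cancel f g -> cancel g f ->
  {in L, forall x, f x \in L'} -> {in L', forall x, g x \in L} ->
  (forall x, w x - x \in L <-> w (f x) - f x \in L') ->
  top_group_iso (torus_fixed L w) (torus_fixed L' w).
Proof.
move=> wB wL wL' fB gB fc gc fK gK fL gL' wf.
exists (torus_hom L' f), (torus_hom L g); split; split.
- elim/torus_ind => x; rewrite torus_hom_pi// => /(torus_fixed_pi _ wB wL)/wf.
  by move/(torus_fixed_pi _ wB wL').
- elim/torus_ind => y; rewrite torus_hom_pi// => /(torus_fixed_pi _ wB wL').
  by rewrite -{1 2}[y]gK => /wf/(torus_fixed_pi _ wB wL).
- by elim/torus_ind => x _; rewrite !torus_hom_pi// fK.
- by elim/torus_ind => y _; rewrite !torus_hom_pi// gK.
- by move=> p q _ _; exact: torus_homD.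
- by apply: continuous_subspaceT; exact: torus_hom_continuous.
- by apply: continuous_subspaceT; exact: torus_hom_continuous.
Qed.

(** The form in which an element of a finite orthogonal group and an element of
a Weyl group are treated alike.  Surjectivity on [L] stands for the inverse of
[w] preserving [L]. *)
Record lattice_isometry (L : zmodClosed t) (w : t -> t) : Prop :=
  LatticeIsometry {
  lattice_isometry_linear : linear w;
  lattice_isometry_dot : forall x y, dot (w x) (w y) = dot x y;
  lattice_isometry_mem : {in L, forall x, w x \in L};
  lattice_isometry_onto : {in L, forall y, exists2 x, x \in L & w x = y} }.

Lemma lattice_isometry_dual_mem L w : lattice_isometry L w ->
  {in dual_lattice L, forall x, w x \in dual_lattice L}.
Proof.
move=> [_ wdot _ wonto] x /dual_latticeP xL.
apply/dual_latticeP => _ /wonto[y yL <-].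
by rewrite wdot xL.
Qed.

(** Fixed classes of the dual torus are detected by [w - 1] acting on [L]
itself.  By orthogonality, the inner product of [w y - y] with [w z] is
[dot y z - dot y (w z)], and the vectors [w z] run over all of [L]. *)
Lemma dual_fixedP L w y : lattice_isometry L w ->
  w y - y \in dual_lattice L <->
  {in L, forall z, dot y (w z - z) \is a Num.int}.
Proof.
move=> [_ wdot wL wonto].
have wadj z : dot (w y - y) (w z) = - dot y (w z - z).
  by rewrite dotBl wdot dotBr opprB.
split=> [/dual_latticeP hy z zL|hy].
  by rewrite -[dot _ _]opprK -wadj rpredN; exact/hy/wL.
by apply/dual_latticeP => _ /wonto[z zL <-]; rewrite wadj rpredN; exact: hy.
Qed.

Lemma torus_fixed_dual_iso (L : zmodClosed t) (w : t -> t) :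
  is_lattice L -> lattice_isometry L w ->
  top_group_iso (torus_fixed L w) (torus_fixed (dual_lattice L) w).
Proof.
move=> /lattice_dual_bases[e [e' ee']] Lw; have [wlin wdot wL wonto] := Lw.
pose wz := GRing.isLinear.Build R t t *:%R w wlin.
pose wl : {linear t -> t} := HB.pack w wz.
have wB : zmod_morphism w by exact: (raddfB wl).
have hB : zmod_morphism (fun x => w x - x).
  move=> x y; rewrite wB !opprB addrACA [RHS]addrACA; congr (_ + _).
  by rewrite addrC.
have hL : {in L, forall x, w x - x \in L} by move=> x xL; rewrite rpredB ?wL.
have [a [a' [b [b' [d [aa' bb' hE]]]]]] := smith_dual_bases hB hL ee'.
have b'b := dual_bases_sym bb'.
apply: (torus_fixed_iso (f := transfer a' b') (g := transfer b a)) => //.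
- exact: lattice_isometry_dual_mem.
- exact: transfer_zmod_morphism.
- exact: transfer_zmod_morphism.
- exact: transfer_continuous.
- exact: transfer_continuous.
- exact: transferK aa' b'b.
- exact: transferK b'b aa'.
- exact: transfer_mem aa' b'b.
- exact: transfer_mem b'b aa'.
move=> x; set y := transfer a' b' x.
(* The conditions on [x] and on [y] are both the integrality of all the
   [dot x (a' i) * d i]. *)
have ya i : dot y (w (a i) - a i) = dot x (a' i) * (d i)%:~R.
  by rewrite hE -scaler_int dotZr (dot_transfer _ _ _ b'b) mulrC.
have xb' i : dot (w x - x) (b' i) = dot x (a' i) * (d i)%:~R.
  have [_ ea _ _] := aa'; have [bb'E _ _ _] := bb'.
  have -> : w x - x = transfer a' (fun j => b j *~ d j) x.
    rewrite /transfer {1 2}(ea x) -[w]/(wl : t -> t) linear_sum -sumrB.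
    by apply: eq_bigr => j _; rewrite linearZ -scalerBr -hE.
  rewrite dot_suml (bigD1 i)//= dotZl -scaler_int dotZl bb'E eqxx mulr1.
  rewrite big1 ?addr0// => j ji.
  by rewrite dotZl -scaler_int dotZl bb'E (negbTE ji) !mulr0.
split.
  move=> /(dual_bases_memP _ bb') x_int; apply/dual_fixedP => // z zL.
  have [m ->] := dual_bases_coord_int aa' zL.
  have -> : w (\sum_i a i *~ m i) - \sum_i a i *~ m i =
      \sum_i (w (a i) - a i) *~ m i.
    rewrite -[w]/(wl : t -> t) linear_sum -sumrB.
    by apply: eq_bigr => i _; rewrite raddfMz mulrzBl.
  rewrite dot_sumr rpred_sum// => i _.
  by rewrite -scaler_int dotZr rpredM ?intr_int// ya -xb'.
move=> /(dual_fixedP _ Lw) y_int; apply/(dual_bases_memP _ bb') => i.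
by rewrite xb' -ya; apply: y_int; have [_ _ aL _] := aa'.
Qed.

End FixedSets.

(** * The two sources of lattice isometries *)

Section Isometries.
Variables (R : realType) (t : euclideanType R).

Lemma orthogonal_action_isometry (W : finGroupType) (act : W -> t -> t)
    (L : zmodClosed t) (w : W) :
  orthogonal_action act -> preserves act L -> lattice_isometry L (act w).
Proof.
move=> [act1 actM actL actD] WL; split; [exact: actL|exact: actD|exact: WL|].
move=> y yL; exists (act w^-1%g y); first exact: WL.
by rewrite -actM mulgV act1.
Qed.

(** Seen through the coroot, the reflection subtracts [dot x a] times
[coroot a], where [dot x a] is an integer because the root [a] is a character,
and [coroot a] is a cocharacter. *)
Lemma reflection_cochar (D : rootDatum t) (a : t) : a \in Defs.roots D ->
  {in cochar D, forall x, reflection a x \in cochar D}.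
Proof.
move=> aD x xL; rewrite -reflection_coroot /reflection corootK rpredB//.
have /dual_latticeP/(_ x xL)/intrP[m] := roots_char aD.
by rewrite dotC => ->; rewrite scaler_int rpredMz// coroots_cochar.
Qed.

Lemma weyl_group_isometry (D : rootDatum t) (w : t -> t) :
  weyl_group D w -> lattice_isometry (cochar D) w.
Proof.
elim=> [|a {}w aD _ [wlin wdot wL wonto]].
  by split=> // y yL; exists y.
split=> [c x y|x y|x xL|y yL] /=.
- by rewrite wlin reflectionD reflectionZ.
- by rewrite dot_reflection wdot.
- exact/reflection_cochar/wL.
have [x xL wx] := wonto _ (reflection_cochar aD yL).
by exists x; rewrite //= wx reflectionK.
Qed.

End Isometries.

(** * Fixed sets in dual tori *)

Theorem theorem5 (R : realType) (t : euclideanType R) :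
  (forall (W : finGroupType) (act : W -> t -> t) (Gamma : zmodClosed t),
     orthogonal_action act -> is_lattice Gamma -> preserves act Gamma ->
     forall w : W,
       top_group_iso (torus_fixed Gamma (act w))
                     (torus_fixed (dual_lattice Gamma) (act w))) /\
  (forall (D : rootDatum t) (w : t -> t), weyl_group D w ->
     top_group_iso (torus_fixed (cochar D) w)
                   (torus_fixed (cochar (langlands_dual D)) w)).
Proof.
split=> [W act L oW latL WL w|D w Dw].
  exact/torus_fixed_dual_iso/orthogonal_action_isometry.
apply: torus_fixed_dual_iso; first exact: cochar_lattice.
exact: weyl_group_isometry.
Qed.
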